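(* Consider the abstract budgeted query model described in the context, with the extended feedback query $\mathrm{query}_{\mathrm{ext}}$. Run the algorithm IBEX: set $C_1 = C_{\min}$ and, for $k = 1,2,\ldots$, set $b_k = 2^k$ and $C_{k+1} = \mathrm{exp\_search}(C_k, b_k, \mathrm{query}_{\mathrm{ext}})$, the whole process stopping as soon as a terminating query is made. Then the total number of expansions performed by IBEX is at most $$4\,n_*\,n_{\mathrm{exp}}(C_{\min}, C^*, \delta_{\min}) = O\!\left(n_* \log\frac{C^*}{\delta_{\min}}\right).$$
   Context: Abstract model. Let $A$ be a nondecreasing list of real numbers, each at least $1$, possibly with repetitions (repeated values are counted separately). For $C \ge 1$ let $n(C) = |\{v \in A : v \le C\}|$. Fix $C^* \in A$ and let $n_* = n(C^* )$. Let $C_{\min} = \min A$. For a budget $b$ let $C_{\mathrm{crit}}(b) = \min\{v \in A : n(v) > b\}$. For real $C$ let $A_{>}(C) = \min\{v \in A : v > C\}$ and $A_{\le}(C) = \max\{v\in A : v \le C\}$; for $C \in A$ let $\delta(C) = A_{>}(C) - A_{\le}(C)$, and let $\delta_{\min} = \min\{\delta(C) : C \in A,\ C \le C^*\}$. Queries. A query takes a cost limit $C$ and a budget $b \in \{1,2,\ldots\}\cup\{\infty\}$ and performs at most $\min\{b, n(C)\}$ expansions. If $n_* \le n(C) \le b$, the query is terminating: it ends the whole interaction (an optimal solution is found). Otherwise it returns an interval containing $C_{\mathrm{crit}}(b)$. In the extended feedback model, $\mathrm{query}_{\mathrm{ext}}(C,b) = [A_{>}(C), \infty]$ if $C < C_{\mathrm{crit}}(b)$,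 and $\mathrm{query}_{\mathrm{ext}}(C,b) = [1, v]$ for some (arbitrary) $v \in [C_{\mathrm{crit}}(b), C] \cap A$ if $C \ge C_{\mathrm{crit}}(b)$. The number of expansions of an algorithm is the sum of the expansions over all queries it makes. Exponential search $\mathrm{exp\_search}(\mathrm{start}, b, \mathrm{query})$: set $\mathrm{low} = \mathrm{start}$, $\mathrm{high} = \infty$; repeat: if $\mathrm{high} = \infty$ let $C = 2\cdot\mathrm{low}$, else let $C = (\mathrm{low}+\mathrm{high})/2$; replace $[\mathrm{low},\mathrm{high}]$ by $[\mathrm{low},\mathrm{high}] \cap \mathrm{query}(C, b)$; until $\mathrm{low} = \mathrm{high}$; return $\mathrm{low}$. Notation: $\lceil x\rceil_{\ge a} = \max\{a, \lceil x\rceil\}$, $\lfloor x\rfloor_{\ge a} = \max\{a,\lfloor x\rfloor\}$, and $n_{\mathrm{exp}}(\varepsilon, x, \Delta) = 1 + \lceil \log_2(x/\varepsilon)\rceil_{\ge 1} + \lfloor \log_2(x/\Delta)\rfloor_{\ge 0}$.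
   Formalization: The O(n_* log(C*/δ_min)) equality fails uniformly (e.g. A={1,m}, C*=m→∞); it is proved for finite δ_min with δ_min ≤ M·C_min and C* ≥ (1+η)δ_min, the constant depending only on M and η>0. The explicit bound 4 n_* n_exp is proved without restriction. *)

(* Defs.v *)
(* MathComp / MathComp-Analysis. *)
From HB Require Import structures.
From mathcomp Require Import all_boot all_order all_algebra.
From mathcomp Require Import all_classical all_reals all_analysis.

Set Implicit Arguments.
Unset Strict Implicit.
Unset Printing Implicit Defensive.

Import Order.TTheory GRing.Theory Num.Theory.
Import numFieldNormedType.Exports.

Local Open Scope classical_set_scope.
Local Open Scope ring_scope.
Local Open Scope ereal_scope.

(* A finite or infinite nondecreasing list of reals >= 1 is encoded as a
   nondecreasing sequence in \bar R: its items are the finite terms, and a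
   finite list is padded with +oo, which is not an item. *)
Definition cost_list (R : realType) (A : nat -> \bar R) : Prop :=
  nondecreasing_seq A /\ forall i, 1 <= A i.

Definition values (R : realType) (A : nat -> \bar R) : set R :=
  [set v | exists i, A i = v%:E].

(* Items are counted with multiplicity, hence the cardinality of a set of
   indices; [counting] is +oo on infinite sets. *)
Definition ncost (R : realType) (A : nat -> \bar R) (C : \bar R) : \bar R :=
  counting [set i | A i < +oo /\ A i <= C].

(* The infima and the supremum below are the minima and the maximum of the
   model: a nonempty set of values has a least element because A is a
   sequence, and [cost_le] is only used at values.  The minimum of the empty
   set is +oo. *)
Definition Cmin (R : realType) (A : nat -> \bar R) : R := inf (values A).

Definition Ccrit (R : realType) (A : nat -> \bar R) (b : \bar R) : \bar R :=
  ereal_inf (EFin @` [set v | values A v /\ b < ncost A v%:E]).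

Definition cost_gt (R : realType) (A : nat -> \bar R) (C : \bar R) : \bar R :=
  ereal_inf (EFin @` [set v | values A v /\ C < v%:E]).

Definition cost_le (R : realType) (A : nat -> \bar R) (C : \bar R) : \bar R :=
  ereal_sup (EFin @` [set v | values A v /\ v%:E <= C]).

(* [gap A C] is +oo when C is the largest value of A. *)
Definition gap (R : realType) (A : nat -> \bar R) (C : R) : \bar R :=
  cost_gt A C%:E - cost_le A C%:E.

Definition gap_min (R : realType) (A : nat -> \bar R) (Cs : R) : \bar R :=
  ereal_inf (gap A @` [set C | values A C /\ (C <= Cs)%R]).

Inductive answer (R : realType) : Type :=
  | Solved
  | Interval (lo hi : \bar R).
Arguments Solved {R}.

Definition terminating (R : realType) (A : nat -> \bar R) (Cs : R)
    (C b : \bar R) : Prop :=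
  ncost A Cs%:E <= ncost A C /\ ncost A C <= b.

(* A relation rather than a function: the upper end v is arbitrary. *)
Inductive query_ext (R : realType) (A : nat -> \bar R) (Cs : R)
    (C b : \bar R) : answer R -> Prop :=
  | query_solved :
      terminating A Cs C b -> query_ext A Cs C b Solved
  | query_below :
      ~ terminating A Cs C b -> C < Ccrit A b ->
      query_ext A Cs C b (Interval (cost_gt A C) +oo)
  | query_above (v : R) :
      ~ terminating A Cs C b -> Ccrit A b <= C ->
      values A v -> Ccrit A b <= v%:E -> v%:E <= C ->
      query_ext A Cs C b (Interval 1 v%:E).

Definition next_limit (R : realType) (low high : \bar R) : \bar R :=
  if high == +oo then 2%:E * low else (low + high) * (2^-1)%:E.

Definition budget (R : realType) (k : nat) : \bar R := (2 ^+ k)%:E.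
Arguments budget {R}.

(* [Searching k low high]: IBEX is about to execute the body of the loop of
   exp_search(C_k, b_k, query_ext) with the current interval [low, high]. *)
Inductive config (R : realType) : Type :=
  | Searching (k : nat) (low high : \bar R)
  | Stopped.
Arguments Stopped {R}.

(* [ibex_step A Cs c e c']: the next query leads from c to c' and performs e
   expansions.  When low = high, exp_search returns C_(k+1) = low and the
   search of index k+1 starts from [low, +oo]. *)
Inductive ibex_step (R : realType) (A : nat -> \bar R) (Cs : R) :
    config R -> nat -> config R -> Prop :=
  | step_solved k low high e :
      let C := next_limit low high in
      query_ext A Cs C (budget k) Solved ->
      e%:R%:E <= mine (budget k) (ncost A C) ->
      ibex_step A Cs (Searching k low high) e Stopped
  | step_loop k low high e lo hi :
      let C := next_limit low high in
      query_ext A Cs C (budget k) (Interval lo hi) ->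
      e%:R%:E <= mine (budget k) (ncost A C) ->
      maxe low lo != mine high hi ->
      ibex_step A Cs (Searching k low high) e
        (Searching k (maxe low lo) (mine high hi))
  | step_return k low high e lo hi :
      let C := next_limit low high in
      query_ext A Cs C (budget k) (Interval lo hi) ->
      e%:R%:E <= mine (budget k) (ncost A C) ->
      maxe low lo = mine high hi ->
      ibex_step A Cs (Searching k low high) e
        (Searching k.+1 (maxe low lo) +oo)
  | step_stopped : ibex_step A Cs Stopped 0 Stopped.

(* A run is an infinite sequence of configurations, eventually constantly
   [Stopped] if IBEX stops; e t is the number of expansions of query t. *)
Definition ibex_run (R : realType) (A : nat -> \bar R) (Cs : R)
    (c : nat -> config R) (e : nat -> nat) : Prop :=
  c 0%N = Searching 1 (Cmin A)%:E +oo /\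
  forall t, ibex_step A Cs (c t) (e t) (c t.+1).

Definition expansions (R : realType) (e : nat -> nat) : \bar R :=
  \sum_(0 <= t <oo) (e t)%:R%:E.
Arguments expansions {R}.

Definition log2 (R : realType) (x : R) : R := (ln x / ln 2)%R.

(* The value +oo of the last argument occurs when all items equal C^*; then
   log2 (x / Delta) is -oo and the last term is 0. *)
Definition n_exp (R : realType) (eps x : R) (Delta : \bar R) : int :=
  (1 + Num.max 1 (Num.ceil (log2 (x / eps)))
     + (if Delta is d%:E then Num.max 0 (Num.floor (log2 (x / d))) else 0))%R.

Definition ibex_bound (R : realType) (A : nat -> \bar R) (Cs : R) : \bar R :=
  4%:E * ncost A Cs%:E * ((n_exp (Cmin A) Cs (gap_min A Cs))%:~R)%:E.

(* Main.v *)
(* With 0-based indices C_crit(b) = A b, so a search returns a value <= C^* only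
   when its budget is < n_*; hence every budget ever used is at most 2 n_*.
   In one search, m failed doublings force low > 2^m C_min while low <= C^*,
   which bounds the doublings by ceil(log2 (C^* / C_min)), at least 1.  The
   first finite interval has length <= low <= C^*, each later query halves it,
   and two distinct ends, the lower one at most C^*, are at least delta_min
   apart: at most 1 + floor(log2 (C^* / delta_min)) further queries.  The same
   count applies to the last search, whose upper end stays above C^* and
   which can therefore only end with a terminating query.  A
   geometric sum of the budgets 2^k <= 2 n_* gives the factor 4 n_*. *)
Require Import Defs.
From HB Require Import structures.
From mathcomp Require Import all_boot all_order all_algebra.
From mathcomp Require Import all_classical all_reals all_analysis.
From mathcomp Require Import zify ring lra.

Set Implicit Arguments.
Unset Strict Implicit.

Import Order.TTheory GRing.Theory Num.Theory.
Import numFieldNormedType.Exports.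

Local Open Scope classical_set_scope.
Local Open Scope ring_scope.
Local Open Scope ereal_scope.

(** * Counting items *)

Lemma counting_le (R : realType) (X Y : set nat) :
  X `<=` Y -> counting X <= counting Y :> \bar R.
Proof.
move=> XY; rewrite /counting; case: asboolP => [fX|nX]; case: asboolP => [fY|nY].
- by rewrite lee_fin ler_nat; apply: finmap.fsubset_leq_card; rewrite -fset_set_sub.
- by rewrite leey.
- by case: nX; exact: sub_finite_set fY.
- by [].
Qed.

Lemma counting_II (R : realType) (n : nat) : counting `I_n = n%:R%:E :> \bar R.
Proof.
by rewrite /counting asboolT//; congr (_%:R%:E); apply: card_fset_set; rewrite card_eqxx.
Qed.

Lemma ncost_le (R : realType) (A : nat -> \bar R) (C D : \bar R) :
  C <= D -> ncost A C <= ncost A D.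
Proof.
by move=> CD; apply: counting_le => i /= [fi iC]; split=> //; exact: le_trans CD.
Qed.

(** As [A] is sorted, the counted indices form an initial segment, so there are more than [b] of
    them exactly when [b] is one of them. *)
Lemma lt_ncost (R : realType) (A : nat -> \bar R) (b : nat) (C : \bar R) :
  nondecreasing_seq A ->
  b%:R%:E < ncost A C <-> A b < +oo /\ A b <= C.
Proof.
move=> Amono; split=> [bC|[Abfin AbC]]; last first.
  apply: (@lt_le_trans _ _ (counting `I_b.+1)).
    by rewrite counting_II lte_fin ltr_nat.
  by apply: counting_le => i /=; rewrite ltnS => /Amono ib; split;
    [exact: le_lt_trans Abfin | exact: le_trans AbC].
apply: contrapT => nAb; move: bC; rewrite ltNge => /negP; apply.
rewrite -counting_II; apply: counting_le => i /= [fi iC].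
rewrite ltnNge; apply/negP => /Amono bi; apply: nAb.
by split; [exact: le_lt_trans fi | exact: le_trans iC].
Qed.

Lemma ncostT (R : realType) (A : nat -> \bar R) (C : R) :
  (forall i, A i <= C%:E) -> ncost A C%:E = +oo.
Proof.
move=> AC; rewrite /ncost (_ : [set _ | _] = setT).
  by rewrite /counting asboolF//; exact: infinite_nat.
by apply/seteqP; split=> // i _; split=> //; apply: le_lt_trans (AC i) (ltry _).
Qed.

Lemma le_ncost (R : realType) (A : nat -> \bar R) (N : nat) (C : R) :
  (forall i, (i < N)%N -> A i <= C%:E) -> N%:R%:E <= ncost A C%:E.
Proof.
move=> AC; rewrite -counting_II; apply: counting_le => i /= /AC iC.
by split=> //; apply: le_lt_trans iC (ltry _).
Qed.

Lemma cost_list_NNy (R : realType) (A : nat -> \bar R) i : cost_list A -> -oo < A i.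
Proof. by case=> _ A1; apply: lt_le_trans (A1 i); rewrite ltNyr. Qed.

(** * Critical cost, next values and gaps *)

Lemma Ccrit_nat (R : realType) (A : nat -> \bar R) (b : nat) :
  cost_list A -> Ccrit A b%:R%:E = A b.
Proof.
move=> AL; have [Amono _] := AL; apply/eqP; rewrite eq_le; apply/andP; split.
- case E : (A b) => [r| |]; [|by rewrite leey|by have := cost_list_NNy b AL; rewrite E].
  apply: ereal_inf_lbound; exists r => //; split; first by exists b.
  by apply/lt_ncost => //; rewrite E ltry.
- apply: le_ereal_inf_tmp => _ [v [_ /lt_ncost] + <-].
  by move=> /(_ Amono)[].
Qed.

(** The infimum is attained at the first index whose term exceeds [C]; that term may be the padding
    [+oo]. *)
Lemma cost_gt_least (R : realType) (A : nat -> \bar R) (C : \bar R) i :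
  cost_list A -> C < A i ->
  [/\ exists j, cost_gt A C = A j, C < cost_gt A C & cost_gt A C <= A i].
Proof.
move=> AL CAi; have [Amono _] := AL.
have exC : exists j, C < A j by exists i.
case: (ex_minnP exC) => j CAj jmin.
suff -> : cost_gt A C = A j by split=> //; [exists j | exact/Amono/jmin].
apply/eqP; rewrite eq_le; apply/andP; split.
- case E : (A j) => [r| |]; [|by rewrite leey|by have := cost_list_NNy j AL; rewrite E].
  by apply: ereal_inf_lbound; exists r => //; split; [exists j | rewrite -E].
- apply: le_ereal_inf_tmp => _ [v [[l Al] Cv] <-].
  by rewrite -Al; apply/Amono/jmin; rewrite Al.
Qed.

Lemma cost_gt_infty (R : realType) (A : nat -> \bar R) (C : \bar R) :
  (forall v, values A v -> v%:E <= C) -> cost_gt A C = +oo.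
Proof.
move=> AC; rewrite /cost_gt (_ : [set _ | _] = set0) ?image_set0 ?ereal_inf0//.
by apply/seteqP; split=> // v [/AC vC]; rewrite ltNge vC.
Qed.

Lemma cost_le_value (R : realType) (A : nat -> \bar R) (v : R) :
  values A v -> cost_le A v%:E = v%:E.
Proof.
move=> Av; apply/eqP; rewrite eq_le; apply/andP; split.
- by apply: ge_ereal_sup => _ [w [_ wv] <-].
- by apply: ereal_sup_ubound; exists v.
Qed.

Lemma gap_min_le (R : realType) (A : nat -> \bar R) (Cs x y : R) :
  values A x -> (x <= Cs)%R -> values A y -> (x < y)%R ->
  gap_min A Cs <= (y - x)%:E.
Proof.
move=> Ax xCs Ay xy; apply: (@le_trans _ _ (gap A x)).
  by apply: ereal_inf_lbound; exists x.
rewrite /gap cost_le_value// EFinB leeB//.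
by apply: ereal_inf_lbound; exists y.
Qed.

Lemma gap_gt0 (R : realType) (A : nat -> \bar R) (x : R) :
  cost_list A -> values A x -> 0 < gap A x.
Proof.
move=> AL Ax; rewrite /gap cost_le_value// sube_gt0.
have [[i xi]|nx] := pselect (exists i, x%:E < A i).
  by have [] := cost_gt_least AL xi.
rewrite cost_gt_infty ?ltry// => v [i Ai].
by rewrite leNgt; apply/negP => xv; apply: nx; exists i; rewrite Ai.
Qed.

(* Only finitely many values are at most [Cs], even when [Cs] has infinitely
   many copies. *)
Lemma gap_min_gt0 (R : realType) (A : nat -> \bar R) (Cs : R) :
  cost_list A -> values A Cs -> 0 < gap_min A Cs.
Proof.
move=> AL [n An]; have [Amono _] := AL.
have [d d0 dgap] : exists2 d : R, (0 < d)%R &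
    forall i x, (i < n.+1)%N -> A i = x%:E -> d%:E <= gap A x.
  elim: n.+1 => [|m [d d0 dgap]]; first by exists 1%R.
  have [[x Ax]|nx] := pselect (exists x, A m = x%:E); last first.
    exists d => // i x; rewrite ltnS leq_eqVlt => /orP[/eqP-> Ax|/dgap dg]; last exact: dg.
    by case: nx; exists x.
  have [d' d'0 d'gap] : exists2 d' : R, (0 < d')%R & d'%:E <= gap A x.
    have : 0 < gap A x by apply: gap_gt0 => //; exists m.
    by case: (gap A x) => [r r0| _|//]; [exists r | exists 1%R; rewrite ?leey].
  exists (Num.min d d'); first by rewrite lt_min d0.
  move=> i y; rewrite ltnS leq_eqVlt => /orP[/eqP-> |/dgap dg Ai].
    by rewrite Ax => -[<-]; apply: le_trans d'gap; rewrite lee_fin ge_min lexx orbT.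
  by apply: le_trans (dg _ Ai); rewrite lee_fin ge_min lexx.
apply: (@lt_le_trans _ _ d%:E); first by rewrite lte_fin.
apply: le_ereal_inf_tmp => _ [x [[i Ai] xCs] <-].
have [iN|/ltnW ni] := ltnP i n.+1; first exact: dgap iN Ai.
(* An index beyond [n] with a value at most [Cs] carries another copy of [Cs], so it has the gap of
   index [n]. *)
apply: (dgap n) => //; rewrite An; congr EFin; apply: le_anti.
by rewrite xCs andbT -lee_fin -An -Ai Amono.
Qed.

(** * The smallest value *)

Lemma Cmin_le (R : realType) (A : nat -> \bar R) (v : R) :
  cost_list A -> values A v -> (Cmin A <= v)%R.
Proof.
move=> [_ A1] Av; apply: ge_inf => //.
by exists 1%R => w [i Ai]; rewrite -lee_fin -Ai.
Qed.

Lemma Cmin_value (R : realType) (A : nat -> \bar R) (v : R) :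
  cost_list A -> values A v -> A 0%N = (Cmin A)%:E.
Proof.
move=> AL Av; have [Amono A1] := AL; have [n An] := Av.
have : A 0%N <= v%:E by rewrite -An Amono.
case E : (A 0%N) => [r|//|]; last by have := cost_list_NNy 0 AL; rewrite E.
move=> _; congr EFin; apply: le_anti; rewrite Cmin_le// ?andbT; last by exists 0%N.
apply: lb_le_inf; first by exists v.
by move=> w [i Ai]; rewrite -lee_fin -E -Ai Amono.
Qed.

(** * Invariant of a single search *)

Lemma budget_nat (R : realType) (k : nat) : budget k = (2 ^ k)%N%:R%:E :> \bar R.
Proof. by rewrite /budget natrX. Qed.

(* A limit [C >= Cs] below C_crit(b) has n_* <= n(C) <= b, so it would terminate. *)
Lemma lt_limit (R : realType) (A : nat -> \bar R) (Cs : R) (C : \bar R) (k : nat) :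
  cost_list A -> ~ terminating A Cs C (budget k) -> C < Ccrit A (budget k) ->
  C < Cs%:E.
Proof.
rewrite budget_nat => AL nt; rewrite Ccrit_nat// => CA.
rewrite ltNge; apply/negP => CsC; apply: nt; split; first exact: ncost_le.
rewrite leNgt; apply/negP => /lt_ncost[]; first by case: AL.
by move=> _; rewrite leNgt CA.
Qed.

(* [x, high] after [m] queries of exp_search(C_k, 2^k, query_ext).  While
   high = +oo the lower end has doubled [m] times; afterwards [q] counts the
   halvings of an interval whose initial length was at most its lower end. *)
Definition bracket (R : realType) (A : nat -> \bar R) (Cs : R) (E k : nat)
    (x : R) (high : \bar R) (m : nat) : Prop :=
  [/\ values A x, (x <= Cs)%R, x%:E <= A (2 ^ k)%N, A (2 ^ k)%N <= high &
   high = +oo /\ (m = 0%N \/ (2 ^+ m * Cmin A < x)%R) \/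
   exists y q, [/\ high = y%:E, values A y, (x < y)%R, (m <= E + q)%N &
                   (2 ^+ q * (y - x) <= Cs)%R]].

(* With [m] queries of the doubling phase done and high still +oo, another one
   fits in [E]; the disjunct [m = 0] is the clause [>= 1] in [n_exp]. *)
Definition exponential_bound (R : realType) (A : nat -> \bar R) (Cs : R) (E : nat) :=
  forall m, m = 0%N \/ (2 ^+ m * Cmin A < Cs)%R -> (m < E)%N.

(** Here [d] stands for the distance of two distinct values left after [q] halvings. The condition
    is vacuous if [gap_min] is [+oo]. *)
Definition binary_bound (R : realType) (A : nat -> \bar R) (Cs : R) (F : nat) :=
  forall q d, gap_min A Cs <= d%:E -> (2 ^+ q * d <= Cs)%R -> (q <= F)%N.

Lemma bracket_lt (R : realType) (A : nat -> \bar R) (Cs : R) (E F k : nat) x high m :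
  exponential_bound A Cs E -> binary_bound A Cs F ->
  bracket A Cs E k x high m -> (m < 1 + E + F)%N.
Proof.
move=> hE hF [Ax xCs _ _ [[_ hm]|[y [q [_ Ay xy mq yx]]]]].
  rewrite -addnA add1n ltnS; apply: leq_trans (leq_addr _ _); apply: ltnW; apply: hE.
  by case: hm => [->|hm]; [left | right; exact: lt_le_trans xCs].
rewrite -addnA add1n ltnS (leq_trans mq)// leq_add2l.
exact: hF (gap_min_le Ax xCs Ay xy) yx.
Qed.

(** The first conclusions also hold when the two ends meet, where they identify the returned value
    as [A (2 ^ k)]; the bracket survives only between distinct ends. *)
Lemma bracket_query (R : realType) (A : nat -> \bar R) (Cs : R) (E k : nat) x high m lo hi :
  cost_list A -> values A Cs -> exponential_bound A Cs E ->
  bracket A Cs E k x high m ->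
  query_ext A Cs (next_limit x%:E high) (budget k) (Defs.Interval lo hi) ->
  exists2 x', maxe x%:E lo = x'%:E &
    [/\ values A x', (x' <= Cs)%R, x'%:E <= A (2 ^ k)%N & A (2 ^ k)%N <= mine high hi] /\
    (x'%:E != mine high hi -> bracket A Cs E k x' (mine high hi) m.+1).
Proof.
move=> AL [n An] hE [Ax xCs xA Ah hph].
have [Amono A1] := AL.
have x1 : (1 <= x)%R by case: Ax => i Ai; rewrite -lee_fin -Ai.
set C := next_limit _ _.
have [r Cr xr] : exists2 r, C = r%:E & (x <= r)%R.
  rewrite /C /next_limit; case: hph => [[-> _]|[y [q [-> _ xy _ _]]]] /=.
    by exists (2 * x)%R => //; lra.
  by exists ((x + y) / 2)%R => //; lra.
move: Cr xr; rewrite /C => {C} Cr xr q.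
move Ea : (Defs.Interval lo hi) q => a q; case: q Ea => [//|nt CC [-> ->]|v nt CC Av Cv vC [-> ->]].
- have CCs := lt_limit AL nt CC.
  move: CC CCs; rewrite budget_nat Ccrit_nat// Cr => rA rCs.
  have [[j lj] rlo loA] := cost_gt_least AL rA.
  (* [Cs] is itself a value above the limit, so the next value after the limit cannot pass it. *)
  have loCs : cost_gt A r%:E <= Cs%:E.
    by move: rCs; rewrite -An => /(cost_gt_least AL)[].
  move: lj rlo loA loCs; case E0 : (cost_gt A r%:E) => [x'| //|//] lj rx' x'A x'Cs.
  move: rx' x'Cs; rewrite lte_fin lee_fin => rx' x'Cs.
  have Ax' : values A x' by exists j.
  rewrite miney; exists x'; first by apply/max_idPr; rewrite lee_fin; lra.
  split=> // xh; split=> //.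
  have xh' : x'%:E < high by rewrite lt_neqAle xh (le_trans x'A).
  move: Cr; rewrite /next_limit; case: hph => [[eh hm]|[y [p [eh Ay xy mq yx]]]].
    rewrite eh eqxx => -[rE]; left; split=> //; right; rewrite exprS -mulrA.
    case: hm => [->|hm]; last by lra.
    rewrite expr0 mul1r; have := Cmin_le AL Ax; lra.
  rewrite eh /= => -[rE]; right; exists y, p.+1; split=> //.
  + by move: xh'; rewrite eh lte_fin.
  + by rewrite addnS.
  (* The lower end passes the midpoint, so the length at least halves. *)
  + apply: le_trans yx; rewrite exprSr -mulrA ler_wpM2l ?exprn_ge0//; lra.
- move: CC Cv; rewrite budget_nat Ccrit_nat// Cr => CC Cv.
  have rh : r%:E <= high.
    move: Cr; rewrite /next_limit; case: hph => [[-> _]|[y [p [-> _ xy _ _]]]] /=; first by rewrite leey.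
    by move=> [<-]; rewrite lee_fin; lra.
  have vr : (v <= r)%R by rewrite -lee_fin -Cr.
  rewrite (min_idPr _); last by apply: le_trans rh; rewrite lee_fin.
  exists x; first by apply/max_idPl; rewrite lee_fin.
  split=> // xh; split=> //; right.
  have xv : (x < v)%R by rewrite -lte_fin lt_neqAle xh (le_trans xA).
  move: Cr; rewrite /next_limit; case: hph => [[eh hm]|[y [p [eh Ay xy mq yx]]]].
    (* The first finite upper end is at most [2 * x], so the length is at most [x <= Cs] and the
       count of halvings starts at 0. *)
    rewrite eh eqxx => -[rE]; exists v, 0%N; split=> //; last by rewrite expr0; lra.
    by rewrite addn0; apply: hE; case: hm => [->|hm]; [left | right; exact: lt_le_trans xCs].
  rewrite eh /= => -[rE]; exists v, p.+1; split=> //.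
  + by rewrite addnS ltnS.
  + apply: le_trans yx; rewrite exprSr -mulrA ler_wpM2l ?exprn_ge0//; lra.
Qed.

(** * Cost of a whole run *)

(* [s] is the number of expansions so far.  Each completed search i < k cost at
   most (1 + E + F) * 2^i, hence (1 + E + F) * (2^k - 2) in total; the [- 2] is
   moved to the left to avoid truncated subtraction. *)
Definition ibex_invariant (R : realType) (A : nat -> \bar R) (Cs : R)
    (N E F s : nat) (c : config R) : Prop :=
  match c with
  | Stopped => (s <= 4 * N * (1 + E + F))%N
  | Searching k low high => exists x m,
      [/\ low = x%:E, bracket A Cs E k x high m, (2 ^ k <= 2 * N)%N &
          (s + 2 * (1 + E + F) <= (1 + E + F) * 2 ^ k + m * 2 ^ k)%N]
  end.

(** With [Q = 1 + E + F], the invariant and [m < Q] give [s <= 2 * Q * 2 ^ k], where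
    [2 ^ k <= 2 * N]. *)
Lemma ibex_invariant_le (R : realType) (A : nat -> \bar R) (Cs : R) (N E F s : nat) c :
  exponential_bound A Cs E -> binary_bound A Cs F ->
  ibex_invariant A Cs N E F s c -> (s <= 4 * N * (1 + E + F))%N.
Proof.
move=> hE hF; case: c => [k low high|//] [x [m [_ /(bracket_lt hE hF) mQ kN sQ]]].
move: mQ sQ; set Q := (1 + E + F)%N; nia.
Qed.

Lemma ibex_invariant_step (R : realType) (A : nat -> \bar R) (Cs : R)
    (N E F s e : nat) (c c' : config R) :
  cost_list A -> values A Cs -> (forall n, A n <= Cs%:E -> (n < N)%N) ->
  exponential_bound A Cs E -> binary_bound A Cs F ->
  ibex_invariant A Cs N E F s c -> ibex_step A Cs c e c' ->
  ibex_invariant A Cs N E F (s + e) c'.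
Proof.
move=> AL ACs AN hE hF inv st.
have eb k C : e%:R%:E <= mine (budget k) (ncost A C) -> (e <= 2 ^ k)%N.
  by rewrite budget_nat le_min lee_fin ler_nat => /andP[].
case: st inv eb => {c e c'} [k low high e C _ +|k low high e lo hi C q +|k low high e lo hi C q +|].
- move=> eC [x [m [_ /(bracket_lt hE hF) mQ kN sQ]]] /(_ _ _ eC) eb /=.
  move: mQ sQ; set Q := (1 + E + F)%N; nia.
- move=> eC lh [x [m [lx br kN sQ]]] /(_ _ _ eC) eb /=.
  move: q lh; rewrite /C lx => q lh.
  have [x' x'E [_ br']] := bracket_query AL ACs hE br q.
  exists x', m.+1; split=> //; first by apply: br'; rewrite -x'E.
  move: sQ; set Q := (1 + E + F)%N; nia.
- move=> eC lh [x [m [lx br kN sQ]]] /(_ _ _ eC) eb /=.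
  move: q lh; rewrite /C lx => q lh.
  have [x' x'E [[Ax' x'Cs x'A Ah] _]] := bracket_query AL ACs hE br q.
  (* The ends enclose the critical cost, so they meet there. As it is at most [Cs], its index is
     below [N], which leaves room to double the budget. *)
  have Ak : A (2 ^ k)%N = x'%:E by apply: le_anti; rewrite x'A -x'E lh Ah.
  have kN' : (2 ^ k < N)%N by apply: AN; rewrite Ak lee_fin.
  have mQ := bracket_lt hE hF br.
  exists x', 0%N; split=> //.
  + split=> //; [|by rewrite leey|by left; split=> //; left].
    by rewrite -Ak; case: AL => + _; apply; rewrite leq_exp2l.
  + by rewrite expnS leq_mul2l ltnW.
  (* The finished search made [m + 1 <= Q] queries, so its cost raises [Q * 2 ^ k] to at most
     [Q * 2 ^ k.+1]. *)
  + move: mQ sQ; rewrite expnS; set Q := (1 + E + F)%N; nia.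
- by rewrite addn0.
Qed.

Lemma expansions_le (R : realType) (e : nat -> nat) (B : nat) :
  (forall t, (\sum_(0 <= i < t) e i <= B)%N) -> expansions e <= B%:R%:E :> \bar R.
Proof.
move=> eB; apply: lime_le.
  by apply: is_cvg_nneseries => i _ _; rewrite lee_fin ler0n.
apply: nearW => t; rewrite sumEFin lee_fin -natr_sum ler_nat; exact: eB.
Qed.

Lemma ibex_expansions (R : realType) (A : nat -> \bar R) (Cs : R) (N E F : nat) c e :
  cost_list A -> values A Cs -> (0 < N)%N -> (forall n, A n <= Cs%:E -> (n < N)%N) ->
  exponential_bound A Cs E -> binary_bound A Cs F -> ibex_run A Cs c e ->
  expansions e <= (4 * N * (1 + E + F))%N%:R%:E :> \bar R.
Proof.
move=> AL ACs N0 AN hE hF [c0 cS]; apply: expansions_le => t.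
apply: (ibex_invariant_le hE hF (c := c t)).
elim: t => [|t IHt]; last first.
  by rewrite big_nat_recr//=; exact: ibex_invariant_step (cS t).
rewrite big_geq// c0; have A0 := Cmin_value AL ACs; exists (Cmin A), 0%N; split=> //.
- split; [by exists 0%N|exact: Cmin_le| |by rewrite leey|by left; split=> //; left].
  by rewrite -A0; case: AL => + _; exact.
- by rewrite leq_pmulr.
- by rewrite mul0n addn0 add0n expn1 mulnC.
Qed.

(** * Logarithms and the explicit bound *)

Lemma exp2_le_log2 (R : realType) (x : R) (q : nat) :
  (0 < x)%R -> (2 ^+ q <= x)%R = (q%:R <= log2 x)%R.
Proof.
move=> x0; have l2 : (0 < ln 2 :> R)%R by rewrite ln_gt0 ?ltr1n.
by rewrite /log2 ler_pdivlMr// mulr_natl -lnXn// ler_ln// posrE ?exprn_gt0.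
Qed.

Lemma exp2_lt_log2 (R : realType) (x : R) (q : nat) :
  (0 < x)%R -> (2 ^+ q < x)%R = (q%:R < log2 x)%R.
Proof.
move=> x0; have l2 : (0 < ln 2 :> R)%R by rewrite ln_gt0 ?ltr1n.
by rewrite /log2 ltr_pdivlMr// mulr_natl -lnXn// ltr_ln// posrE ?exprn_gt0.
Qed.

Lemma Cmin_gt0 (R : realType) (A : nat -> \bar R) (v : R) :
  cost_list A -> values A v -> (0 < Cmin A)%R.
Proof.
move=> AL Av; rewrite -lte_fin -(Cmin_value AL Av).
by case: AL => _ A1; apply: lt_le_trans (A1 0%N); rewrite lte_fin.
Qed.

(** An integer is below a real iff it is below its ceiling, and at most a real iff at most its
    floor; so the two rounded logarithms in [n_exp] serve as [E] and [F]. *)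
Lemma n_exp_bounds (R : realType) (A : nat -> \bar R) (Cs : R) :
  cost_list A -> values A Cs ->
  exists E F : nat, [/\ exponential_bound A Cs E, binary_bound A Cs F &
    n_exp (Cmin A) Cs (gap_min A Cs) = (1 + E + F)%N%:Z].
Proof.
move=> AL ACs; have Cm0 := Cmin_gt0 AL ACs.
have Cs0 : (0 < Cs)%R by apply: lt_le_trans Cm0 _; exact: Cmin_le.
pose c := Num.ceil (log2 (Cs / Cmin A)).
pose f := if gap_min A Cs is d%:E then Num.max 0%R (Num.floor (log2 (Cs / d))) else 0%R.
have f0 : (0 <= f)%R by rewrite /f; case: (gap_min A Cs) => // r; rewrite le_max lexx.
have c0 : (0 <= Num.max 1 c)%R by rewrite le_max ler01.
exists `|Num.max 1%R c|%N, `|f|%N; split.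
- move=> m hm; rewrite -ltz_nat gez0_abs// lt_max.
  case: hm => [->|hm]; first by rewrite ltr01.
  by apply/orP; right; rewrite /c ceil_gt_int -exp2_lt_log2 ?divr_gt0// ltr_pdivlMr.
- move=> q d gd qd; rewrite -lez_nat gez0_abs// /f.
  move: (gap_min_gt0 AL ACs) gd; case: (gap_min A Cs) => [r||]//=.
  rewrite lte_fin lee_fin => r0 rd; rewrite le_max floor_ge_int -exp2_le_log2 ?divr_gt0//.
  rewrite ler_pdivlMr//; apply/orP; right; apply: le_trans qd.
  by rewrite ler_wpM2l ?exprn_ge0.
- by rewrite !PoszD !gez0_abs.
Qed.

Lemma ibex_expansions_le_bound (R : realType) (A : nat -> \bar R) (Cs : R) c e :
  cost_list A -> values A Cs -> ibex_run A Cs c e -> expansions e <= ibex_bound A Cs.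
Proof.
move=> AL ACs run; have [Amono _] := AL; have [n0 An0] := ACs.
have [E [F [hE hF nE]]] := n_exp_bounds AL ACs.
rewrite /ibex_bound nE.
have [[N0 CsN]|nN] := pselect (exists N, Cs%:E < A N); last first.
  (* If no term exceeds [Cs], then [n_*] is infinite and the bound is [+oo]. *)
  rewrite ncostT; last by move=> i; rewrite leNgt; apply/negP => ?; apply: nN; exists i.
  by rewrite gt0_muley ?lte_fin// gt0_mulye ?leey// lte_fin ltr0n.
have exN : exists N, Cs%:E < A N by exists N0.
(* With 0-based indices, the first index above [Cs] is [n_*]. *)
case: (ex_minnP exN) => N {}CsN Nmin.
have AN n : A n <= Cs%:E -> (n < N)%N.
  by move=> nC; rewrite ltnNge; apply/negP => /Amono Nn; move: CsN; rewrite ltNge (le_trans Nn).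
have N1 : (0 < N)%N by apply: leq_ltn_trans (AN n0 _); rewrite ?An0.
apply: le_trans (ibex_expansions AL ACs N1 AN hE hF run) _.
rewrite natrM natrM EFinM EFinM lee_wpmul2r ?lee_fin ?ler0n// lee_wpmul2l ?lee_fin//.
by apply: le_ncost => i iN; rewrite leNgt; apply/negP => /Nmin; rewrite leqNgt iN.
Qed.

(** * Asymptotic form *)

Lemma n_exp_le (R : realType) (eps x d : R) :
  (0 < eps <= x)%R -> (0 < d <= x)%R ->
  ((n_exp eps x d%:E)%:~R <= 2 + log2 (x / eps) + log2 (x / d))%R.
Proof.
move=> /andP[eps0 epsx] /andP[d0 dx].
have l2 : (0 < ln 2 :> R)%R by rewrite ln_gt0 ?ltr1n.
have lge0 y : (0 < y <= x)%R -> (0 <= log2 (x / y))%R.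
  by move=> /andP[y0 yx]; rewrite divr_ge0 ?(ltW l2)// ln_ge0// ler_pdivlMr// mul1r.
have a0 := lge0 eps; have b0 := lge0 d; rewrite eps0 epsx in a0; rewrite d0 dx in b0.
rewrite /n_exp !rmorphD /= lerD//.
  have : ((Num.max 1 (Num.ceil (log2 (x / eps))))%:~R <= 1 + log2 (x / eps))%R; last by lra.
  rewrite maxEle; case: ifP => _; last by rewrite lerDl a0.
  have := ceilB1_lt (log2 (x / eps)); rewrite rmorphB /=; lra.
rewrite maxEle; case: ifP => _; last by rewrite b0.
exact: floor_le.
Qed.

(** [(1 + eta) * delta <= Cs] keeps [ln (Cs / delta)] at least [ln (1 + eta)], so it absorbs
    constants; [delta <= M * Cmin A] bounds [Cs / Cmin A] by [M * (Cs / delta)]. *)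
Lemma ibex_bound_bigO (R : realType) (M eta : R) : (0 < eta)%R ->
  exists2 K : R, (0 < K)%R &
    forall (A : nat -> \bar R) (Cs delta : R),
      cost_list A -> values A Cs -> gap_min A Cs = delta%:E ->
      (delta <= M * Cmin A)%R -> ((1 + eta) * delta <= Cs)%R ->
      ibex_bound A Cs <= K%:E * (ncost A Cs%:E * (ln (Cs / delta))%:E).
Proof.
move=> eta0; have l2 : (0 < ln 2 :> R)%R by rewrite ln_gt0 ?ltr1n.
have l0 : (0 < ln (1 + eta))%R by rewrite ln_gt0// ltrDl.
(* The first summand absorbs 2 and [log2 M], the second the two terms [L / ln 2], one from each
   logarithm. *)
pose D := ((2 + `|log2 M|) / ln (1 + eta) + 2 / ln 2)%R.
have D0 : (0 < D)%R by rewrite addr_gt0// divr_gt0// ltr_wpDr.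
exists (4 * D)%R; first by rewrite mulr_gt0.
move=> A Cs d AL ACs gd dM dCs.
have d0 : (0 < d)%R by rewrite -lte_fin -gd gap_min_gt0.
have Cm0 := Cmin_gt0 AL ACs; have CmCs := Cmin_le AL ACs.
have Cs0 : (0 < Cs)%R by apply: lt_le_trans CmCs.
have M0 : (0 < M)%R by rewrite -(pmulr_lgt0 _ Cm0) (lt_le_trans d0).
set L := ln (Cs / d).
have lL : (ln (1 + eta) <= L)%R.
  by rewrite /L ler_ln ?posrE ?divr_gt0 ?ler_pdivlMr// addr_gt0.
have dCs' : (d <= Cs)%R.
  by apply: le_trans dCs; rewrite mulrDl mul1r lerDl mulr_ge0// ltW.
have nD : ((n_exp (Cmin A) Cs (gap_min A Cs))%:~R <= D * L)%R.
  rewrite gd; apply: le_trans (n_exp_le _ _) _; rewrite ?Cm0 ?d0//.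
  have h1 : (log2 (Cs / Cmin A) <= `|log2 M| + L / ln 2)%R.
    apply: (@le_trans _ _ (log2 M + L / ln 2)%R); last by rewrite lerD2r ler_norm.
    rewrite /log2 -mulrDl ler_wpM2r ?invr_ge0 ?(ltW l2)// /L -lnM ?posrE ?divr_gt0//.
    rewrite ler_ln ?posrE ?mulr_gt0 ?divr_gt0 ?invr_gt0//.
    by rewrite mulrCA ler_wpM2l ?(ltW Cs0)// ler_pdivlMr// mulrC ler_pdivrMr.
  have h2 : (2 + `|log2 M| <= (2 + `|log2 M|) / ln (1 + eta) * L)%R.
    by rewrite mulrAC ler_pdivlMr// ler_wpM2l// addr_ge0.
  have h3 : log2 (Cs / d) = (L / ln 2)%R by [].
  rewrite /D mulrDl h3.
  have -> : (2 / ln 2 * L = L / ln 2 + L / ln 2)%R by field; rewrite gt_eqF.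
  lra.
rewrite /ibex_bound EFinM -!muleA lee_wpmul2l ?lee_fin//.
by rewrite muleCA lee_wpmul2l ?lee_fin.
Qed.

Theorem theorem1 (R : realType) :
  (forall (A : nat -> \bar R) (Cs : R),
     cost_list A -> values A Cs ->
     forall (c : nat -> config R) (e : nat -> nat),
       ibex_run A Cs c e -> expansions e <= ibex_bound A Cs) /\
  (forall M eta : R, (0 < eta)%R ->
     exists2 K : R, (0 < K)%R &
       forall (A : nat -> \bar R) (Cs delta : R),
         cost_list A -> values A Cs -> gap_min A Cs = delta%:E ->
         (delta <= M * Cmin A)%R -> ((1 + eta) * delta <= Cs)%R ->
         ibex_bound A Cs <= K%:E * (ncost A Cs%:E * (ln (Cs / delta))%:E)).
Proof.
split; last exact: ibex_bound_bigO.
by move=> A Cs AL ACs c e; exact: ibex_expansions_le_bound.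
Qed.
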